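(* Let $\mathcal{SF}$ be the set of square-free positive integers and list $\mathcal{SF}=(s_n)_{n\ge1}$ in increasing order. Then $(s_n)$ is rotationally distributed in $\mathbb N$ but not uniformly distributed in $\mathbb Z$. Thus $(s_n)$ is not uniformly behaved in $\mathbb N$.
   Context: A positive integer $n$ is square-free if $p^2\nmid n$ for all primes $p$. Let $(a_n)_{n\ge1}$ be a sequence of natural numbers. A sequence $(x_n)$ of real numbers is uniformly distributed modulo 1 if for all $0\le s<t\le1$, $\lim_{N\to\infty}\frac1N\#\{1\le n\le N: s\le x_n \bmod 1\le t\}=t-s$. The sequence $(a_n)$ is rotationally distributed in $\mathbb N$ if for every irrational $0<\theta<1$ the sequence $(a_n\theta)$ is uniformly distributed modulo 1. $(a_n)$ is uniformly distributed in $\mathbb Z$ if for all $m\in\mathbb N$, $m\ge1$, and $r\in\{0,\dots,m-1\}$, $\lim_{N\to\infty}\frac1N\#\{1\le n\le N: a_n\equiv r \pmod m\}=\frac1m$. $(a_n)$ is uniformly behaved in $\mathbb N$ if for every real $0<\theta<1$, $\lim_{N\to\infty}\frac1N\sum_{n=1}^N e^{2\pi i a_n\theta}=0$. *)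

(* Defs.v *)
From mathcomp Require Import all_boot all_order all_algebra.
From mathcomp Require Import all_classical all_reals all_analysis.
From mathcomp Require Export complex.

Set Implicit Arguments.
Unset Strict Implicit.
Unset Printing Implicit Defensive.

Import Order.TTheory GRing.Theory Num.Theory.
Import numFieldNormedType.Exports.

Local Open Scope classical_set_scope.
Local Open Scope ring_scope.

(* Sequences (x_n)_{n >= 1} are functions on nat whose value at 0 is ignored. *)

Definition square_free (n : nat) : Prop :=
  (0 < n)%N /\ forall p : nat, prime p -> ~~ (p ^ 2 %| n)%N.

Definition lists_increasingly (A : set nat) (s : nat -> nat) : Prop :=
  (forall m n : nat, (1 <= m)%N -> (m < n)%N -> (s m < s n)%N) /\
  (forall k : nat, A k <-> exists2 n : nat, (1 <= n)%N & s n = k).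

Definition mod1 (R : realType) (x : R) : R := x - (Num.floor x)%:~R.

(* #{1 <= n <= N : P n} *)
Definition count_upto (P : pred nat) (N : nat) : nat :=
  count P (index_iota 1 N.+1).

Definition uniformly_distributed_mod1 (R : realType) (x : nat -> R) : Prop :=
  forall s t : R, 0 <= s -> s < t -> t <= 1 ->
    (fun N : nat => (count_upto (fun n => s <= mod1 (x n) <= t) N)%:R / N%:R)
      @ \oo --> t - s.

Definition rotationally_distributed (R : realType) (a : nat -> nat) : Prop :=
  forall theta : R, irrational theta -> 0 < theta -> theta < 1 ->
    uniformly_distributed_mod1 (fun n => (a n)%:R * theta).

Definition uniformly_distributed_Z (R : realType) (a : nat -> nat) : Prop :=
  forall m r : nat, (1 <= m)%N -> (r < m)%N ->
    (fun N : nat => (count_upto (fun n => a n == r %[mod m]) N)%:R / N%:R : R)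
      @ \oo --> (m%:R^-1 : R).

(* e^{i x} for real x *)
Definition expi (R : realType) (x : R) : R[i] := (cos x +i* sin x)%C.

(* R[i]^o carries the topology of the complex modulus. *)
Definition uniformly_behaved (R : realType) (a : nat -> nat) : Prop :=
  forall theta : R, 0 < theta -> theta < 1 ->
    (fun N : nat =>
       N%:R^-1 * \sum_(1 <= n < N.+1) expi (2 * pi * (a n)%:R * theta) : R[i]^o)
      @ \oo --> (0 : R[i]^o).

Lemma square_free_listable :
  exists s : nat -> nat, lists_increasingly square_free s.
Proof.
have ex k : exists m, (k < m)%N && `[< square_free m >].
  have [p kp pp] := prime_above k; exists p; rewrite kp; apply/asboolP.
  split=> [|q qp]; first exact: prime_gt0.
  apply/negP => q2p.
  have qdp : (q %| p)%N by apply: dvdn_trans q2p; rewrite expnS dvdn_mulr.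
  move: q2p; rewrite (eqP (_ : q == p)); last by rewrite -dvdn_prime2.
  move=> /dvdn_leq -/(_ (prime_gt0 pp)).
  by rewrite leqNgt -mulnn ltn_Pmull ?prime_gt0 ?prime_gt1.
pose s := fix s n := if n is n'.+1 then ex_minn (ex (s n')) else 0%N.
have sS n : (s n < s n.+1)%N by rewrite /=; case: ex_minnP => m /andP[].
have s_sf n : square_free (s n.+1).
  by rewrite /=; case: ex_minnP => m /andP[_ /asboolP].
have sP n m : square_free m -> (s n < m)%N -> (s n.+1 <= m)%N.
  by move=> mA nm /=; case: ex_minnP => k _; apply; rewrite nm; apply/asboolP.
have s_lt m n : (m < n)%N -> (s m < s n)%N.
  elim: n => // n IH; rewrite ltnS leq_eqVlt => /predU1P[->|/IH mn] //.
  exact: ltn_trans mn (sS n).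
exists s; split=> [m n _|k]; first exact: s_lt.
split=> [kA|[[//|n] _ <-]]; last exact: s_sf.
have sn n : (n <= s n)%N by elim: n => // n IH; apply: leq_trans (sS n).
have exk : exists n, (k <= s n)%N by exists k; apply: sn.
case: (ex_minnP exk) => -[|n] kn min; first by case: kA => k0 _; rewrite leqNgt k0 in kn.
exists n.+1 => //; apply/eqP; rewrite eqn_leq kn andbT; apply: sP => //.
by rewrite ltnNge; apply/negP => /min; rewrite ltnn.
Qed.

(* Main.v *)
Require Import Defs.
From mathcomp Require Import all_boot all_order all_algebra.
From mathcomp Require Import all_classical all_reals all_analysis.
From mathcomp Require Import ring lra.

(** The multiples of 4 are missing from the square-free integers. This alone
    excludes uniform distribution modulo 4. It also excludes uniform behaviour:
    for [k] not divisible by 4 the numbers [e^(2 i pi k j / 4)], [j = 1, 2, 3],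
    add up to -1, so the exponential averages of the list at 1/4, 1/2 and 3/4
    always add up to -1 ([quarter_turns_sum]).

    For rotational distribution, the square-free integers are approximated by
    the integers divisible by no [d ^ 2] with [2 <= d < D]. These form a periodic
    set, and among [1, ..., N] the approximation errs on at most
    [N * (1 / D ^ 2 + 1 / (D + 1) ^ 2 + ...) <= N / (D - 1)] integers
    ([sieve_error]). Since the square-free integers have positive lower density
    ([sqfree_density]), this error is also small relative to their number. It
    remains to see that for irrational [theta] the points [k * theta] modulo 1,
    with [k] in a periodic set, are equidistributed ([periodic_count_in_arc]).

    That last point needs no exponential sum. Some multiple [h] of the period
    brings [h * theta] within a small distance [d > 0] above an integer
    ([small_multiple]). Along [k, k + h, k + 2 h, ...] membership in the periodic
    set does not change, while the point on the circle advances by [d] each time,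
    and such a slow progression visits an arc about as often as its length
    predicts, uniformly in the starting point ([small_step_equidistribution]).
    Counting functions are nearly invariant under the shifts by multiples of [h],
    so the estimate along each progression passes to the whole count.

    Only lower bounds for open arcs are proved along the way. Applied to the
    complementary arcs they give the upper bounds ([listing_rotational]). *)

Set Implicit Arguments.
Unset Strict Implicit.
Unset Printing Implicit Defensive.

Import Order.TTheory GRing.Theory Num.Theory.
Import numFieldNormedType.Exports.

Local Open Scope classical_set_scope.
Local Open Scope ring_scope.

(** * Fractional parts *)

Lemma mod1_ge0 (R : realType) (x : R) : 0 <= mod1 x.
Proof. by rewrite subr_ge0 floor_le. Qed.

Lemma mod1_lt1 (R : realType) (x : R) : mod1 x < 1.
Proof. by have := floorD1_gt x; rewrite /mod1 intrD; lra. Qed.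

Lemma floor_mod1 (R : realType) (x : R) : x = (Num.floor x)%:~R + mod1 x.
Proof. by rewrite /mod1; lra. Qed.

Lemma mod1D_int (R : realType) (x : R) (m : int) : mod1 (x + m%:~R) = mod1 x.
Proof. by rewrite /mod1 floorDrz ?intr_int// intrKfloor intrD; lra. Qed.

Definition in_arc (R : realType) (a b x : R) : bool := a < mod1 x < b.

(** * Equidistribution of a progression with a small step *)

Definition clamp (R : realType) (l u : R) : R := Num.max 0 (Num.min u l).

Lemma clampP (R : realType) (l u : R) : 0 <= l ->
  [\/ u <= 0 /\ clamp l u = 0, 0 <= u <= l /\ clamp l u = u
    | l <= u /\ clamp l u = l].
Proof.
move=> l0; rewrite /clamp; have [ul|/ltW lu] := leP u l; last first.
  by apply: Or33; rewrite (max_idPr l0).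
have [u0|/ltW u0] := leP 0 u; last by apply: Or31.
by apply: Or32.
Qed.

(** For [0 <= a], [0 < d] and [a + d <= b <= 1] this is a primitive, vanishing at
    0, of the indicator function of the set of the reals whose fractional part
    lies in the closed interval from [a + d] to [b]. *)
Definition potential (R : realType) (a b d y : R) : R :=
  (b - a - d) * (Num.floor y)%:~R
  + clamp (b - a - d) (mod1 y - a - d).

(** The potential is 1-Lipschitz, and it only grows on the points with
    fractional part between [a + d] and [b]. A step of length [d] that meets such
    points in more than an endpoint starts in the open arc from [a] to [b],
    because the arc was shortened by [d] on the left. *)
Lemma potential_step (R : realType) (a b d y : R) :
    0 <= a -> b <= 1 -> 0 < d -> a + d <= b ->
  potential a b d (y + d) - potential a b d y <= d * (in_arc a b y)%:R.
Proof.
move=> a0 b1 d0 adb; rewrite /potential /in_arc.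
have := mod1_ge0 y; have := mod1_lt1 y.
have := floor_mod1 y; set f := mod1 y; set n := Num.floor y => yE f1 f0.
have out : ~~ (a < f < b) -> f <= a \/ b <= f.
  by rewrite negb_and -!leNgt => /orP.
have L0 : 0 <= b - a - d by lra.
have [fd1|fd1] := ltP (f + d) 1.
  have nE : Num.floor (y + d) = n by apply: floor_def; rewrite intrD; lra.
  rewrite /mod1 nE.
  have -> : y + d - n%:~R - a - d = f - a by lra.
  case: (boolP (a < f < b)) => [/andP[]|/out []]; rewrite ?mulr1 ?mulr0;
    case: (clampP (f - a) L0) => -[? ->];
    case: (clampP (f - a - d) L0) => -[? ->]; lra.
have nE : Num.floor (y + d) = n + 1 by apply: floor_def; rewrite !intrD; lra.
rewrite /mod1 nE.
have -> : y + d - (n + 1)%:~R - a - d = f - 1 - a by rewrite intrD; lra.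
have -> : clamp (b - a - d) (f - 1 - a) = 0.
  by case: (clampP (f - 1 - a) L0) => -[? ->]; lra.
have -> : (b - a - d) * (n + 1)%:~R = (b - a - d) * n%:~R + (b - a - d).
  by rewrite intrD; ring.
case: (boolP (a < f < b)) => [/andP[]|/out []]; rewrite ?mulr1 ?mulr0;
  case: (clampP (f - a - d) L0) => -[? ->]; lra.
Qed.

(** The difference is the primitive of a function of period 1 and mean 0. *)
Lemma potential_approx (R : realType) (a b d y : R) : a + d <= b ->
  `|potential a b d y - (b - a - d) * y| <= b - a - d.
Proof.
move=> adb; have := mod1_ge0 y; have := mod1_lt1 y.
have := floor_mod1 y; rewrite /potential.
set f := mod1 y; set L := b - a - d => yE f1 f0.
have L0 : 0 <= L by rewrite /L; lra.
have Lf0 : 0 <= L * f by rewrite mulr_ge0.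
have LfL : L * f <= L by rewrite ler_piMr// ltW.
rewrite [in L * y]yE mulrDr ler_norml; apply/andP.
by case: (clampP (f - a - d) L0) => -[? ->]; lra.
Qed.

(** Telescoping the potential along the progression: it increases in total by
    about [(b - a - d) * (K * d)], and by at most [d] at each visit to the arc.
    The bound does not depend on [x], which is what lets it be averaged over all
    starting points. *)
Lemma small_step_equidistribution (R : realType) (a b d x : R) (K : nat) :
    0 <= a -> b <= 1 -> 0 < d ->
  (b - a - d) * (K%:R * d) - 2 <=
    d * \sum_(j < K) (in_arc a b (x + j%:R * d))%:R.
Proof.
move=> a0 b1 d0; have [adb|adb] := leP (a + d) b; last first.
  apply: (@le_trans _ _ 0).
    have: 0 <= (a + d - b) * (K%:R * d).
      by rewrite mulr_ge0 ?mulr_ge0 ?ler0n//; lra.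
    by rewrite !mulrDl !mulNr; lra.
  by apply: mulr_ge0; [lra | apply: sumr_ge0 => j _; rewrite ler0n].
pose F := potential a b d.
have : F (x + K%:R * d) - F x <=
    d * \sum_(j < K) (in_arc a b (x + j%:R * d))%:R.
  rewrite big_distrr /= -(big_mkord predT (fun j => d * (in_arc a b (x + j%:R * d))%:R)).
  have -> : F (x + K%:R * d) - F x =
      \sum_(0 <= j < K) (F (x + j.+1%:R * d) - F (x + j%:R * d)).
    by rewrite (telescope_sumr (fun j => F (x + j%:R * d)))// mul0r addr0.
  apply: ler_sum_nat => j _; rewrite -natr1 mulrDl mul1r addrA.
  exact: potential_step.
apply: le_trans.
have := potential_approx (x + K%:R * d) adb.
have := potential_approx x adb.
rewrite -/F !ler_norml mulrDr; lra.
Qed.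

(** * Small steps of an irrational rotation *)

Lemma irrational_multiple_neq (R : realType) (theta : R) (q : nat) (m : int) :
  irrational theta -> (0 < q)%N -> q%:R * theta - m%:~R != 0.
Proof.
move=> irr q0; apply/negP; rewrite subr_eq0 => /eqP E; apply: irr.
exists (m%:~R / q%:R) => //; rewrite rmorphM/= fmorphV/= ratr_int ratr_nat -E.
by rewrite mulrC mulKf// pnatr_eq0 -lt0n.
Qed.

(** Pigeonhole: with [K > 1 / e] boxes of width [1 / K], two of the [K + 1]
    fractional parts of [0, theta, ..., K * theta] share a box. *)
Lemma near_integer_multiple (R : realType) (theta e : R) : 0 < e ->
  exists (q : nat) (m : int), (0 < q)%N /\ `|q%:R * theta - m%:~R| < e.
Proof.
move=> e0; pose K := (Num.trunc e^-1).+1.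
have Ke : e^-1 < K%:R by exact: truncnS_gt.
have K0 : 0 < K%:R :> R by rewrite ltr0n.
pose box (i : nat) := Num.trunc (K%:R * mod1 (i%:R * theta)).
have boxK (i : nat) : (box i < K)%N.
  rewrite truncn_lt_nat; last by rewrite mulr_ge0 ?mod1_ge0 ?ltW.
  by rewrite gtr_pMr ?mod1_lt1.
have : ~~ injectiveb (fun i : 'I_K.+1 => Ordinal (boxK i)).
  by apply/negP => /injectiveP /leq_card; rewrite !card_ord ltnn.
case/injectivePn => i [j ij [box_ij]].
have near (k : nat) : (box k)%:R <= K%:R * mod1 (k%:R * theta) < (box k).+1%:R.
  by apply: truncn_itv; rewrite mulr_ge0 ?mod1_ge0 ?ltW.
wlog lt_ij : i j ij box_ij / (i < j)%N.
  move=> H; case: (ltngtP i j) => [|ji|/ord_inj]; first exact: H ij box_ij.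
    by apply: (H j i) => //; rewrite eq_sym.
  by move/eqP; rewrite (negbTE ij).
exists (j - i)%N, (Num.floor (j%:R * theta) - Num.floor (i%:R * theta)).
rewrite subn_gt0 lt_ij; split=> //.
rewrite natrB ?(ltnW lt_ij)// intrB.
have -> : (j%:R - i%:R) * theta - ((Num.floor (j%:R * theta))%:~R -
   (Num.floor (i%:R * theta))%:~R) = mod1 (j%:R * theta) - mod1 (i%:R * theta).
  by rewrite /mod1; ring.
rewrite -(ltr_pM2l K0).
apply: (@lt_trans _ _ 1); last by rewrite -ltr_pdivrMr// div1r.
rewrite -{1}(gtr0_norm K0) -normrM mulrBr ltr_norml.
have := near i; have := near j; rewrite box_ij -!natr1; lra.
Qed.

Lemma small_multiple (R : realType) (theta e : R) : irrational theta -> 0 < e ->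
  exists (q : nat) (m : int), (0 < q)%N /\ 0 < q%:R * theta - m%:~R < e.
Proof.
move=> irr e0; have e1 : 0 < Num.min e 1 by rewrite lt_min e0 ltr01.
have [q [m [q0]]] := near_integer_multiple theta e1; rewrite lt_min => /andP[qm qm1].
have := irrational_multiple_neq m irr q0; rewrite neq_lt => /orP[neg|pos]; last first.
  by exists q, m; split=> //; rewrite pos -(gtr0_norm pos).
move: qm qm1; rewrite (ltr0_norm neg); set d := - (_ - _) => de d1.
have d0 : 0 < d by rewrite /d; lra.
(* Walking from 1 backwards by steps of length [d], the last point before
   crossing 0 lies between 0 and [d]. *)
pose n := Num.trunc d^-1.
have : n%:R <= d^-1 < n.+1%:R by apply: truncn_itv; rewrite invr_ge0 ltW.
case/andP; rewrite -(ler_pM2r d0) -(ltr_pM2r d0) mulVf ?gt_eqF// => n1 n2.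
have n0 : (0 < n)%N.
  by rewrite lt0n; apply: contraTneq n2 => ->; rewrite mul1r -leNgt ltW.
have nq0 : (0 < n * q)%N by rewrite muln_gt0 n0.
exists (n * q)%N, (n%:Z * m - 1); split=> //.
have E : (n * q)%:R * theta - (n%:Z * m - 1)%:~R = 1 - n%:R * d.
  by rewrite natrM intrB intrM /d pmulrn; ring.
have := irrational_multiple_neq (n%:Z * m - 1) irr nq0; rewrite E.
move: n2; rewrite -natr1; lra.
Qed.

(** * Irrational rotations along a periodic set *)

Lemma count_uptoE (P : pred nat) N : count_upto P N = (\sum_(1 <= k < N.+1) P k)%N.
Proof. by rewrite /count_upto -sum1_count big_mkcond /=. Qed.

Lemma natr_count_upto (R : realType) (P : pred nat) N :
  (count_upto P N)%:R = \sum_(1 <= k < N.+1) (P k)%:R :> R.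
Proof. by rewrite count_uptoE natr_sum. Qed.

Lemma sub_count_upto (P Q : pred nat) N :
  (forall k, P k -> Q k) -> (count_upto P N <= count_upto Q N)%N.
Proof. by move=> PQ; apply: sub_count. Qed.

Lemma count_upto_shift (P : pred nat) h N :
  (count_upto (fun k => P (k + h)%N) N <= count_upto P N + h)%N.
Proof.
rewrite /count_upto /index_iota !subn1 /=.
have -> : count (fun k => P (k + h)%N) (iota 1 N) = count P (iota (1 + h) N).
  by rewrite [(1 + h)%N]addnC iotaDl count_map; apply: eq_count => k /=; rewrite addnC.
apply: (@leq_trans (count P (iota 1 (h + N)))).
  by rewrite iotaD count_cat leq_addl.
by rewrite addnC iotaD count_cat leq_add2l -[leqRHS](size_iota (1 + N)) count_size.
Qed.

(** Let [h] be a multiple of the period such that [h * theta] is within [e / 2]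
    above an integer. Shifting the counted set by [j * h] changes its counting
    function by at most [j * h]; so, up to a constant, the count may be replaced
    by its mean over the shifts [j < K]. For each [k] in the periodic set the
    shifted points move by small steps, and equidistribute by
    [small_step_equidistribution]. *)
Lemma periodic_count_in_arc (R : realType) (P : pred nat) (M : nat)
    (theta a b e : R) :
  (0 < M)%N -> (forall k, P (k + M)%N = P k) -> irrational theta ->
  0 <= a -> b <= 1 -> 0 < e ->
  exists C : nat, forall N,
    (b - a - e) * (count_upto P N)%:R - C%:R <=
    (count_upto (fun k => P k && in_arc a b (k%:R * theta)) N)%:R.
Proof.
move=> M0 PM irr a0 b1 e0.
have irrM : irrational (M%:R * theta).
  move=> [r _ rE]; apply: irr; exists (r / M%:R) => //.
  by rewrite rmorphM/= rE fmorphV/= ratr_nat mulrAC mulfV ?mul1r ?pnatr_eq0 -?lt0n.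
have e2 : 0 < e / 2 by lra.
have [q [m [q0]]] := small_multiple irrM e2.
set d := _ - _ => /andP[d0 de].
have PMj k j : P (k + j * M)%N = P k.
  by elim: j => [|j <-]; rewrite ?addn0// mulSn [(M + _)%N]addnC addnA PM.
pose h := (q * M)%N.
have arcE (k j : nat) :
    in_arc a b ((k + j * h)%:R * theta) = in_arc a b (k%:R * theta + j%:R * d).
  rewrite /in_arc; suff -> : mod1 ((k + j * h)%:R * theta) =
    mod1 (k%:R * theta + j%:R * d) by [].
  rewrite -(mod1D_int (_ + _) (j%:Z * m)) intrM /d /h natrD !natrM pmulrn.
  by congr mod1; ring.
(* [K] makes the additive constant 2 of [small_step_equidistribution], once
   divided by [K * d], at most [e / 2]. *)
pose K := (Num.trunc (4 / (d * e))).+1.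
have K0 : 0 < K%:R :> R by rewrite ltr0n.
have KP : 2 <= e / 2 * (K%:R * d).
  have : 4 / (d * e) < K%:R by exact: truncnS_gt.
  by rewrite ltr_pdivrMr ?mulr_gt0//; nra.
exists (K * h)%N => N.
pose f k := P k && in_arc a b (k%:R * theta).
have shifts : \sum_(j < K) (count_upto (fun k => f (k + j * h)%N) N)%:R <=
    K%:R * ((count_upto f N)%:R + (K * h)%:R) :> R.
  rewrite mulr_natl -[K in leRHS]card_ord -sumr_const; apply: ler_sum => j _.
  rewrite -natrD ler_nat (leq_trans (count_upto_shift _ _ _))// leq_add2l.
  by rewrite card_ord leq_mul// ltnW.
have swap : \sum_(j < K) (count_upto (fun k => f (k + j * h)%N) N)%:R =
    \sum_(1 <= k < N.+1)
      (P k)%:R * \sum_(j < K) (in_arc a b (k%:R * theta + j%:R * d))%:R :> R.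
  under eq_bigr do rewrite natr_count_upto.
  rewrite exchange_big /=; apply: eq_bigr => k _; rewrite big_distrr /=.
  by apply: eq_bigr => j _; rewrite /f arcE -natrM mulnb /h mulnA PMj.
rewrite -(ler_pM2l K0) mulrBr lerBlDr -mulrDr.
apply: le_trans shifts; rewrite swap natr_count_upto !mulr_sumr.
apply: ler_sum => k _; case: (P k); rewrite ?mulr0 ?mul0r// mul1r !mulr1.
rewrite -(ler_pM2l d0).
have := small_step_equidistribution (k%:R * theta) K a0 b1 d0.
apply: le_trans.
have : 0 <= (e / 2 - d) * (K%:R * d) by rewrite mulr_ge0 ?mulr_ge0 ?ltW// subr_gt0.
lra.
Qed.

(** * Square-free integers as a limit of periodic sets *)

Definition sqfree (k : nat) : bool := `[< square_free k >].

(** A periodic superset of the square-free integers, which decreases to them on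
    the positive integers as [D] grows. *)
Definition sieved (D k : nat) : bool :=
  all (fun d => ~~ (d ^ 2 %| k)%N) (index_iota 2 D).

Lemma sieved_periodic D k : sieved D (k + D`! ^ 2) = sieved D k.
Proof.
apply: eq_in_all => d; rewrite mem_index_iota => /andP[d2 dD].
by rewrite dvdn_addl// dvdn_exp2r// dvdn_fact// (leq_trans _ d2)//= ltnW.
Qed.

Lemma sqfree_sieved D k : sqfree k -> sieved D k.
Proof.
move=> /asboolP[_ sf]; apply/allP => d; rewrite mem_index_iota => /andP[d2 _].
apply: contra (sf (pdiv d) (pdiv_prime d2)) => /(dvdn_trans _); apply.
by rewrite dvdn_exp2r// pdiv_dvd.
Qed.

(** Comparison with the telescoping series of [1 / (d - 1) - 1 / d]. *)
Lemma inv_squares_tail (R : realFieldType) D n : (1 < D)%N ->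
  \sum_(D <= d < n) (d ^ 2)%:R^-1 <= (D.-1)%:R^-1 :> R.
Proof.
move=> D1; have [nD|Dn] := leqP n D; first by rewrite big_geq// invr_ge0.
apply: (@le_trans _ _ (\sum_(D <= d < n) ((- (d.+1.-1)%:R^-1) - (- (d.-1)%:R^-1)))).
  apply: ler_sum_nat => d /andP[Dd _].
  have d1 : (1 < d)%N by exact: leq_trans Dd.
  case: d d1 {Dd} => [//|[//|d]] _ /=.
  have x0 : 0 < d.+1%:R :> R by rewrite ltr0n.
  rewrite natrX -[d.+2%:R]natr1 opprK; set x := d.+1%:R in x0 *.
  rewrite -subr_ge0 [- _ + _]addrC.
  have -> : x^-1 - (x + 1)^-1 - ((x + 1) ^+ 2)^-1 = (x * (x + 1) ^+ 2)^-1.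
    by field; rewrite !gt_eqF//; lra.
  by rewrite invr_ge0 mulr_ge0 ?sqr_ge0// ltW.
rewrite (telescope_sumr (fun d => - (d.-1)%:R^-1)) ?(ltnW Dn)// opprK.
by rewrite gerDr oppr_le0 invr_ge0.
Qed.

(** A sieved integer that is not square-free is a multiple of [p ^ 2] for some
    [p >= D], and there are at most [N / d ^ 2] multiples of [d ^ 2] up to [N]. *)
Lemma sieve_error (R : realFieldType) D N : (1 < D)%N ->
  (count_upto (sieved D) N)%:R - (count_upto sqfree N)%:R <=
  N%:R * \sum_(D <= d < N.+1) (d ^ 2)%:R^-1 :> R.
Proof.
move=> D1.
have: (count_upto (sieved D) N <= count_upto sqfree N +
   \sum_(D <= d < N.+1) N %/ d ^ 2)%N.
  under [X in (_ <= _ + X)%N]eq_bigr do rewrite divn_count_dvd.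
  rewrite exchange_big /= !count_uptoE -big_split /= big_nat [leqRHS]big_nat.
  apply: leq_sum => k /andP[k0 kN].
  case sk : (sqfree k); first by rewrite (leq_trans (leq_b1 _))// leq_addr.
  case dk : (sieved D k) => //=.
  have /existsNP[p /not_implyP[pp /negP/negPn pk]] :
      ~ forall p, prime p -> ~~ (p ^ 2 %| k)%N.
    by move=> H; move/asboolP: sk; apply; split.
  have Dp : (D <= p)%N.
    rewrite leqNgt; apply/negP => pD; move/allP: dk => /(_ p).
    by rewrite mem_index_iota prime_gt1// pD pk => /(_ isT).
  have pN : (p < N.+1)%N.
    apply: leq_trans kN; rewrite ltnS (leq_trans _ (dvdn_leq k0 pk))//.
    by rewrite -mulnn leq_pmulr// prime_gt0.
  by rewrite (big_rem p) ?mem_index_iota ?Dp//= pk.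
rewrite -(ler_nat R) natrD natr_sum => H; rewrite lerBlDl; apply: le_trans H _.
rewrite lerD2l mulr_sumr; apply: ler_sum_nat => d /andP[Dd _].
have d2 : 0 < (d ^ 2)%:R :> R by rewrite ltr0n expn_gt0 (leq_trans _ Dd)// ltnW.
by rewrite ler_pdivlMr// -natrM ler_nat leq_divM.
Qed.

(** With [D = 2] nothing is sieved out, and
    [1 / 4 + (1 / 9 + 1 / 16 + ...) <= 1 / 4 + 1 / 2] bounds the proportion of
    the integers that are not square-free. *)
Lemma sqfree_density (N : nat) : (N <= 4 * count_upto sqfree N)%N.
Proof.
have := @sieve_error rat 2 N isT.
have -> : count_upto (sieved 2) N = N.
  by rewrite /count_upto (eq_count (a2 := predT)) ?count_predT ?size_iota ?subn1.
have : \sum_(2 <= d < N.+1) (d ^ 2)%:R^-1 <= 3 / 4 :> rat.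
  have [N2|N2] := leqP N.+1 2; first by rewrite big_geq.
  by rewrite big_ltn//; have := @inv_squares_tail rat 3 N.+1 isT; rewrite natrX /=; lra.
move=> /(ler_wpM2l (ler0n _ N)); rewrite -(ler_nat rat) natrM; lra.
Qed.

(** The sieved sets are periodic, so [periodic_count_in_arc] applies to them; the
    integers wrongly kept by the sieve cost at most [N / (D - 1)], by
    [sieve_error]. *)
Lemma sqfree_count_in_arc (R : realType) (theta a b e : R) :
  irrational theta -> 0 <= a -> b <= 1 -> 0 < e ->
  exists C : nat, forall N,
    (b - a) * (count_upto sqfree N)%:R - e * N%:R - C%:R <=
    (count_upto (fun k => sqfree k && in_arc a b (k%:R * theta)) N)%:R.
Proof.
move=> irr a0 b1 e0.
have e2 : 0 < e / 2 by lra.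
pose D := (Num.trunc (2 / e)).+2.
have De : (D.-1)%:R^-1 < e / 2.
  by rewrite invf_plt ?posrE// invf_div; exact: truncnS_gt.
have M0 : (0 < D`! ^ 2)%N by rewrite expn_gt0 fact_gt0.
have [C HC] := periodic_count_in_arc M0 (sieved_periodic D) irr a0 b1 e2.
exists C => N.
have [ba|ab] := ltP b a.
  apply: (@le_trans _ _ 0); rewrite ?ler0n//.
  have : 0 <= (a - b) * (count_upto sqfree N)%:R by rewrite mulr_ge0//; lra.
  have : 0 <= e * N%:R by rewrite mulr_ge0// ltW.
  have : 0 <= C%:R :> R by [].
  lra.
have sieve_err : (count_upto (sieved D) N)%:R - (count_upto sqfree N)%:R
    <= e / 2 * N%:R :> R.
  apply: le_trans (sieve_error R N (isT : 1 < D)%N) _.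
  rewrite mulrC ler_wpM2r// (le_trans _ (ltW De))//.
  exact: inv_squares_tail.
have sqfree_le : 0 <= (b - a) * ((count_upto (sieved D) N)%:R - (count_upto sqfree N)%:R).
  rewrite mulr_ge0 ?subr_ge0// ler_nat.
  exact: sub_count_upto (@sqfree_sieved D).
have sieved_le : 0 <= e / 2 * (N%:R - (count_upto (sieved D) N)%:R).
  rewrite mulr_ge0 ?(ltW e2)// subr_ge0 ler_nat (leq_trans (count_size _ _))//.
  by rewrite size_iota subn1.
have : (count_upto (fun k => sieved D k && in_arc a b (k%:R * theta)) N +
    count_upto sqfree N <= count_upto (fun k => sqfree k && in_arc a b (k%:R * theta)) N
    + count_upto (sieved D) N)%N.
  rewrite !count_uptoE -!big_split; apply: leq_sum => k _ /=.
  case: (boolP (sqfree k)) => [/(@sqfree_sieved D) ->|_].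
    by [].
  by rewrite addn0 add0n; case: (sieved D k) => //; case: in_arc.
rewrite -(ler_nat R) !natrD => arcs.
have := HC N; lra.
Qed.

(** * The increasing list of the square-free integers *)

Lemma count_listing (s : nat -> nat) (Q : pred nat) N :
  lists_increasingly square_free s -> (0 < N)%N ->
  count_upto (fun n => Q (s n)) N = count_upto (fun k => sqfree k && Q k) (s N).
Proof.
move=> [incr sP] N0.
have incr_leq m n : (0 < m)%N -> (m <= n)%N -> (s m <= s n)%N.
  by move=> m0; rewrite leq_eqVlt => /predU1P[->//|/(incr m n m0)/ltnW].
rewrite /count_upto -count_map.
have -> : count (fun k => sqfree k && Q k) (index_iota 1 (s N).+1) =
    count Q [seq k <- index_iota 1 (s N).+1 | sqfree k].
  by rewrite count_filter; apply: eq_count => k; rewrite /= andbC.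
apply/permP: Q; apply: uniq_perm.
- rewrite map_inj_in_uniq ?iota_uniq// => m n.
  rewrite !mem_index_iota => /andP[m0 _] /andP[n0 _] E.
  by case: (ltngtP m n) => // H;
    [have := incr _ _ m0 H | have := incr _ _ n0 H]; rewrite E ltnn.
- by rewrite filter_uniq// iota_uniq.
move=> k; rewrite mem_filter mem_index_iota ltnS; apply/mapP/and3P.
  move=> [n]; rewrite mem_index_iota ltnS => /andP[n0 nN] ->.
  have sfn : square_free (s n) by apply/sP; exists n.
  by split; [exact/asboolP | exact: sfn.1 | exact: incr_leq].
move=> [/asboolP/sP[n n0 <-] _ nN]; exists n => //.
rewrite mem_index_iota n0 ltnS leqNgt; apply/negP => /(incr _ _ N0).
by rewrite ltnNge nN.
Qed.

Lemma count_sqfree_listing (s : nat -> nat) N :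
  lists_increasingly square_free s -> (0 < N)%N -> count_upto sqfree (s N) = N.
Proof.
move=> hs N0; have := @count_listing s predT N hs N0.
rewrite /count_upto count_predT size_iota subn1 /= => {2}->.
by apply: eq_count => k; rewrite /= andbT.
Qed.

Lemma listing_linear (s : nat -> nat) N :
  lists_increasingly square_free s -> (0 < N)%N -> (s N <= 4 * N)%N.
Proof.
by move=> hs N0; rewrite -{2}(count_sqfree_listing hs N0) sqfree_density.
Qed.

Lemma listing_avoids_4 (s : nat -> nat) n :
  lists_increasingly square_free s -> (0 < n)%N -> ~~ (4 %| s n)%N.
Proof.
move=> [_ sP] n0.
by have [_ /(_ 2 isT)] : square_free (s n) by apply/sP; exists n.
Qed.

(** The error of [sqfree_count_in_arc] is small relative to [s N], hence relative
    to [N], because the list grows linearly. *)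
Lemma listing_count_in_arc (R : realType) (s : nat -> nat) (theta a b e : R) :
  lists_increasingly square_free s ->
  irrational theta -> 0 <= a -> b <= 1 -> 0 < e ->
  exists C : nat, forall N, (0 < N)%N ->
    (b - a - e) * N%:R - C%:R <=
    (count_upto (fun n => in_arc a b ((s n)%:R * theta)) N)%:R.
Proof.
move=> hs irr a0 b1 e0.
have e4 : 0 < e / 4 by lra.
have [C HC] := sqfree_count_in_arc irr a0 b1 e4.
exists C => N N0; have := HC (s N).
rewrite -(@count_listing s (fun k => in_arc a b (k%:R * theta)))// count_sqfree_listing//.
apply: le_trans.
have := listing_linear hs N0; rewrite -(ler_nat R) natrM => /(ler_wpM2l (ltW e4)).
lra.
Qed.

(** Lower bounds on open arcs suffice: the open arcs from 0 to [a] and from [b]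
    to 1 are disjoint from the closed arc from [a] to [b], so their lower bounds
    bound its count from above. *)
Lemma listing_rotational (R : realType) (s : nat -> nat) :
  lists_increasingly square_free s -> rotationally_distributed R s.
Proof.
move=> hs theta irr _ _ a b a0 ab b1; apply/cvgrPdist_le => e e0.
have e3 : 0 < e / 3 by lra.
have [C1 H1] := listing_count_in_arc hs irr a0 b1 e3.
have [C2 H2] := listing_count_in_arc hs irr (lexx 0) (le_trans (ltW ab) b1) e3.
have [C3 H3] := listing_count_in_arc hs irr (le_trans a0 (ltW ab)) (lexx 1) e3.
near=> N.
have N0 : (0 < N)%N by near: N; exact: nbhs_infty_gt.
have N0' : 0 < N%:R :> R by rewrite ltr0n.
have NC : (C1 + C2 + C3)%:R <= e / 3 * N%:R.
  rewrite mulrC -ler_pdivrMr//; near: N; exact: nbhs_infty_ger.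
pose T := count_upto (fun n => a <= mod1 ((s n)%:R * theta) <= b) N.
have open_closed : (count_upto (fun n => in_arc a b ((s n)%:R * theta)) N <= T)%N.
  by apply: sub_count_upto => n /andP[an nb]; rewrite !ltW.
have disjoint : (T + count_upto (fun n => in_arc 0 a ((s n)%:R * theta)) N
    + count_upto (fun n => in_arc b 1 ((s n)%:R * theta)) N <= N)%N.
  rewrite /T !count_uptoE -!big_split /= -[leqRHS](subn1 N.+1) -[leqRHS]muln1.
  rewrite -sum_nat_const_nat; apply: leq_sum => n _; rewrite /in_arc.
  move: (mod1 _) => y; case: (leP a y) => [ay|ya]; case: (leP y b) => [yb|bY] /=.
  - by rewrite andbF.
  - by rewrite andbF; case: (y < 1).
  - by case: (0 < y).
  - by move: (lt_trans (lt_trans ya ab) bY); rewrite ltxx.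
move: open_closed disjoint NC; rewrite -!(ler_nat R) !natrD => oc dj NC.
have := H1 N N0; have := H2 N N0; have := H3 N N0; rewrite -/T.
have : 0 <= C1%:R :> R by [].
have : 0 <= C2%:R :> R by [].
have : 0 <= C3%:R :> R by [].
have -> : b - a - T%:R / N%:R = ((b - a) * N%:R - T%:R) / N%:R.
  by field; rewrite gt_eqF.
rewrite normrM normfV (gtr0_norm N0') ler_pdivrMr// ler_norml; lra.
Unshelve. all: by end_near. Qed.

(** * Sequences avoiding the multiples of 4 *)

Lemma not_uniform_Z_of_avoids_4 (R : realType) (a : nat -> nat) :
  (forall n, (0 < n)%N -> ~~ (4 %| a n)%N) -> ~ uniformly_distributed_Z R a.
Proof.
move=> a4 /(_ 4 0 isT isT).
have -> : (fun N : nat =>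
    (count_upto (fun n => a n == 0 %[mod 4]) N)%:R / N%:R : R) = fun=> 0.
  apply/funext => N; rewrite /count_upto.
  suff -> : count (fun n => a n == 0 %[mod 4]) (index_iota 1 N.+1) = 0%N.
    by rewrite mul0r.
  apply/eqP; rewrite -leqn0 leqNgt -has_count; apply/hasPn => n.
  by rewrite mem_index_iota mod0n => /andP[/a4].
move=> /(cvg_unique (@norm_hausdorff _ _) (@cvg_cst _ _ _ _ _)) /eqP.
by rewrite eq_sym invr_eq0 pnatr_eq0.
Qed.

Lemma expiD (R : realType) (x y : R) : expi (x + y) = expi x * expi y.
Proof. by rewrite /expi cosD sinD; simpc; congr Complex; rewrite addrC. Qed.

Lemma expiMn (R : realType) (x : R) n : expi (x *+ n) = expi x ^+ n.
Proof.
elim: n => [|n IH]; first by rewrite mulr0n expr0 /expi cos0 sin0.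
by rewrite mulrSr expiD IH exprSr.
Qed.

Lemma expi_pihalf (R : realType) : expi (pi / 2) = 'i%C :> R[i].
Proof. by rewrite /expi cos_pihalf sin_pihalf. Qed.

(** The four 4th roots of unity [u ^+ j] with [u = 'i ^+ k != 1] add up to 0. *)
Lemma quarter_turns_sum (R : realType) (k : nat) : ~~ (4 %| k)%N ->
  \sum_(1 <= j < 4) expi (2 * pi * k%:R * (j%:R / 4)) = -1 :> R[i].
Proof.
move=> k4.
have turn (j : nat) : expi (2 * pi * k%:R * (j%:R / 4)) = ('i%C ^+ k) ^+ j :> R[i].
  rewrite -exprM -expi_pihalf -expiMn -(mulr_natr (pi / 2)) natrM; congr expi.
  by field.
under eq_bigr do rewrite turn.
have i2 : 'i%C ^+ 2 = -1 :> R[i] by exact: complex.sqr_i.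
have i4 : 'i%C ^+ 4 = 1 :> R[i] by rewrite (exprM _ 2 2) i2 sqrrN expr1n.
have u4 : ('i%C ^+ k) ^+ 4 = 1 :> R[i] by rewrite exprAC i4 expr1n.
have u1 : 'i%C ^+ k != 1 :> R[i].
  rewrite (divn_eq k 4) exprD mulnC exprM i4 expr1n mul1r.
  have : (0 < k %% 4)%N by rewrite lt0n.
  have : (k %% 4 < 4)%N by rewrite ltn_mod.
  case: (k %% 4)%N => [|[|[|[|]]]]// _ _; rewrite ?expr1 ?exprS ?expr0 ?mulr1.
  - by rewrite eq_complex /= oner_eq0 andbF.
  - by rewrite -expr2 i2 eq_complex /= lt_eqF//; lra.
  - by rewrite -expr2 i2 mulrN1 eq_complex /= oppr_eq0 oner_eq0 andbF.
move: u4 u1; set u := 'i%C ^+ k => u4 u1.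
rewrite 3?big_ltn// big_geq// addr0 expr1 addrA.
have : (u - 1) * (u + u ^+ 2 + u ^+ 3 + 1) = 0.
  by rewrite -(subrr 1) -{3}u4; ring.
move/eqP; rewrite mulf_eq0 subr_eq0 (negbTE u1) addr_eq0 => /eqP E; exact: E.
Qed.

(** By [quarter_turns_sum] the exponential averages at 1/4, 1/2 and 3/4 add up to
    -1, so that the three cannot all tend to 0. *)
Lemma not_uniformly_behaved_of_avoids_4 (R : realType) (a : nat -> nat) :
  (forall n, (0 < n)%N -> ~~ (4 %| a n)%N) -> ~ uniformly_behaved R a.
Proof.
move=> a4 ub.
pose A (theta : R) (N : nat) : R[i]^o :=
  N%:R^-1 * \sum_(1 <= n < N.+1) expi (2 * pi * (a n)%:R * theta).
have cvgA j : (0 < j)%N -> (j < 4)%N -> A (j%:R / 4) @ \oo --> (0 : R[i]^o).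
  move=> j0 j4; apply: ub; rewrite ?divr_gt0 ?ltr0n//.
  by rewrite ltr_pdivrMr// mul1r ltr_nat.
have : A (1%:R / 4) \+ A (2%:R / 4) \+ A (3%:R / 4) @ \oo --> (0 + 0 + 0 : R[i]^o).
  by do 2?[apply: cvgD]; exact: cvgA.
have -> : (0 + 0 + 0 : R[i]^o) = 0 by rewrite !addr0.
have AE N : (0 < N)%N -> A (1%:R / 4) N + A (2%:R / 4) N + A (3%:R / 4) N = -1.
  move=> N0; rewrite /A -!mulrDr -!big_split /=.
  under eq_big_nat => n /andP[n0 _].
    have := quarter_turns_sum R (a4 n n0).
    rewrite 3?big_ltn// big_geq// addr0 addrA => ->.
    over.
  rewrite sumr_const_nat subn1/= -[in LHS](mulr_natl (-1 : R[i])) mulrA mulVf ?mul1r//.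
  by rewrite pnatr_eq0 -lt0n.
move=> cv0.
have : (fun N => A (1%:R / 4) N + A (2%:R / 4) N + A (3%:R / 4) N) @ \oo
    --> (-1 : R[i]^o).
  apply: cvg_near_cst; exists 1%N => // N /= N0; exact: AE.
move=> /(cvg_unique (@norm_hausdorff _ _) cv0) /eqP.
by rewrite eq_sym oppr_eq0 oner_eq0.
Qed.

Theorem theorem7 (R : realType) (s : nat -> nat)
  (hs : lists_increasingly square_free s) :
  [/\ rotationally_distributed R s,
      ~ uniformly_distributed_Z R s
    & ~ uniformly_behaved R s].
Proof.
split; first exact: listing_rotational.
- by apply: not_uniform_Z_of_avoids_4 => n; apply: listing_avoids_4.
- by apply: not_uniformly_behaved_of_avoids_4 => n; apply: listing_avoids_4.
Qed.
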